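(* Given two strings $x$ and $y$ over the integer alphabet $\Sigma=\{1,\ldots,(|x|+|y|)^{\mathcal{O}(1)}\}$, the value $\mathsf{LPALCF}$ — the maximum length of a palindrome that occurs as a factor of both $x$ and $y$ — can be computed in $\mathcal{O}(|x|+|y|)$ time.
   Context: A string $p$ is a palindrome if $p=p^R$, where $p^R$ is the reversal of $p$. A factor of a string is a contiguous substring. *)

(* Defs.v *)
From mathcomp Require Import all_boot.
Set Implicit Arguments.
Unset Strict Implicit.
Unset Printing Implicit Defensive.

Definition palindrome (p : seq nat) : bool := p == rev p.

(* [infix p x] is the library's contiguous-factor relation.  The empty string
   is a palindrome, so the maximum always exists. *)
Definition common_palindrome (x y p : seq nat) : bool :=
  [&& palindrome p, infix p x & infix p y].

Definition is_LPALCF (x y : seq nat) (l : nat) : Prop :=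
  (exists2 p, common_palindrome x y p & size p = l) /\
  (forall p, common_palindrome x y p -> size p <= l).

(* The word RAM with w-bit words: random-access memory addressed by words,
   finitely many registers used by any given program, unit-cost instructions.
   Words are represented by naturals, reduced modulo 2 ^ w whenever they are
   produced, so every register and memory cell always holds a value below
   2 ^ w. *)
Definition to_word (w a : nat) : nat := a %% 2 ^ w.

Inductive binop : Type := Plus | Minus | Times | Quot | Rem.

Inductive instr : Type :=
| Const of nat & nat
| Op of binop & nat & nat & nat
| Read of nat & nat
| Write of nat & nat
| Jump of nat
| JumpLt of nat & nat & nat
| JumpEq of nat & nat & nat.

Definition program : Type := seq instr.

Record state : Type := State {
  pc : nat;
  regs : nat -> nat;
  memory : nat -> nat
}.

Definition upd (f : nat -> nat) (i v : nat) : nat -> nat :=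
  fun j => if j == i then v else f j.

(* Subtraction wraps around; division by 0 returns 0 and remainder by 0
   returns the dividend, as [divn] and [modn] do. *)
Definition eval_binop (w : nat) (o : binop) (a b : nat) : nat :=
  to_word w match o with
            | Plus => a + b
            | Minus => a + 2 ^ w - b
            | Times => a * b
            | Quot => a %/ b
            | Rem => a %% b
            end.

Definition exec (w : nat) (i : instr) (s : state) : state :=
  let: State p R M := s in
  match i with
  | Const r k => State p.+1 (upd R r (to_word w k)) M
  | Op o r a b => State p.+1 (upd R r (eval_binop w o (R a) (R b))) M
  | Read r a => State p.+1 (upd R r (M (R a))) M
  | Write a b => State p.+1 R (upd M (R a) (R b))
  | Jump l => State l R M
  | JumpLt a b l => State (if R a < R b then l else p.+1) R M
  | JumpEq a b l => State (if R a == R b then l else p.+1) R M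
  end.

(* The machine halts when control leaves the program. *)
Definition halted (P : program) (s : state) : bool := size P <= pc s.

Definition step (w : nat) (P : program) (s : state) : state :=
  if onth P (pc s) is Some i then exec w i s else s.

(* Input: the lengths in R[0] and R[1], the letters of x followed by those of
   y in M[0], M[1], and so on; everything else is 0.  The output is R[0]. *)
Definition init (w : nat) (x y : seq nat) : state :=
  State 0
    (fun r => to_word w (nth 0 [:: size x; size y] r))
    (fun a => to_word w (nth 0 (x ++ y) a)).

Definition output (s : state) : nat := regs s 0.

(* On input (x, y), P halts after at most T unit-cost instructions with an
   output satisfying Q. *)
Definition computes_within (w : nat) (P : program) (x y : seq nat) (T : nat)
    (Q : nat -> Prop) : Prop :=
  exists t : nat, let s := iter t (step w P) (init w x y) in
    [/\ t <= T, halted P s & Q (output s)].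

(* x and y are strings over {1, ..., (|x| + |y|) ^ c}. *)
Definition over_integer_alphabet (c : nat) (x y : seq nat) : bool :=
  all (fun a => 1 <= a <= (size x + size y) ^ c) (x ++ y).

(* w >= k * log2 (n + 2); the shift by 2 keeps the logarithm positive when
   n <= 1. *)
Definition word_size_ok (k n w : nat) : bool := (n + 2) ^ k <= 2 ^ w.

(* Main.v *)
Require Import Defs.
From mathcomp Require Import all_boot.
From mathcomp Require Import zify.

(* The palindromic tree (eertree) of x has one node per distinct palindromic
   factor of x, created at the end of its first occurrence; it is built online
   by following suffix links from the longest palindromic suffix. Then y is
   read with the tree frozen, keeping the longest palindromic suffix that has a
   node: palindromic factors of x are closed under stripping both end letters,
   so the same walk along suffix links finds the next one. The answer is the
   longest palindrome met. Every link followed shortens the current palindrome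
   and, while building, also its link, so the time is linear by amortisation.
   Memory is initially zero and word size is c' log n for a constant c' of our
   choice, so edges are stored in a directly addressed table indexed by letter
   and node, and no sorting or hashing of the alphabet is needed.

   Palindromes are encoded by their length plus one, so that 0 stands for the
   imaginary palindrome of length -1, which extends to the one-letter ones. *)

Set Implicit Arguments.
Unset Strict Implicit.
Unset Printing Implicit Defensive.

(** * Palindromic trees *)

Section Palindromes.
Variable z : nat -> nat.

(* [pal_end i L]: the [L - 1] letters of [z] before position [i] form a
   palindrome. *)
Definition pal_end (i L : nat) : Prop :=
  forall j k, i < j + L -> i < k + L -> j + k + L = i + i -> z j = z k.

(* The same [L - 1] letters precede positions [i] and [j]. *)
Definition same_end (i j L : nat) : Prop :=
  forall a b, a < i -> i < a + L -> a + j = b + i -> z a = z b.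

Lemma pal_end0 i : pal_end i 0.
Proof. by move=> j k; lia. Qed.

Lemma pal_end1 i : pal_end i 1.
Proof. by move=> j k; lia. Qed.

(** The letter to the left of the palindrome is at [i - L]. For [L = 0] this is [i] itself, so
    one-letter palindromes need no separate treatment. *)
Lemma pal_endS i L : L <= i ->
  pal_end i.+1 L.+2 <-> pal_end i L /\ z (i - L) = z i.
Proof.
move=> leLi; split=> [pal_iL | [pal_iL zE] j k ltj ltk jk].
  by split=> [j k ltj ltk jk|]; apply: pal_iL; lia.
have [ji | neqj] := eqVneq j i; first by rewrite ji (_ : k = i - L) ?zE //; lia.
have [ki | neqk] := eqVneq k i; first by rewrite ki (_ : j = i - L) ?zE //; lia.
by apply: pal_iL; lia.
Qed.

Lemma same_end_refl i L : same_end i i L.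
Proof. by move=> a b _ _ /addIn ->. Qed.

Lemma same_end0 i j : same_end i j 0.
Proof. by move=> a b; lia. Qed.

Lemma same_end1 i j : same_end i j 1.
Proof. by move=> a b; lia. Qed.

Lemma same_end_sym i j L : L <= i.+1 -> L <= j.+1 ->
  same_end i j L -> same_end j i L.
Proof. by move=> leLi leLj ij a b lta ltja ab; apply/esym/ij; lia. Qed.

Lemma same_end_trans i j k L : L <= j.+1 ->
  same_end i j L -> same_end j k L -> same_end i k L.
Proof.
move=> leLj ij jk a b lta ltia ab.
by rewrite (ij a (a + j - i)) ?(jk (a + j - i) b) //; lia.
Qed.

Lemma same_endW i j L L' : L' <= L -> same_end i j L -> same_end i j L'.
Proof. by move=> leL ij a b lta ltia ab; apply: ij; lia. Qed.

Lemma same_endS i j L : same_end i.+1 j.+1 L.+2 -> same_end i j L.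
Proof. by move=> ij a b lta ltia ab; apply: ij; lia. Qed.

Lemma same_end_last i j L : same_end i.+1 j.+1 L.+2 -> z i = z j.
Proof. by move=> ij; apply: ij; lia. Qed.

Lemma pal_same_end i j L : L <= i.+1 -> L <= j.+1 ->
  same_end i j L -> pal_end i L -> pal_end j L.
Proof.
move=> leLi leLj ij pal_iL a b lta ltb ab.
rewrite -(ij (a + i - j) a) -1?(ij (b + i - j) b); try lia.
by apply: pal_iL; lia.
Qed.

(** Agreement of the last letters is enough: in a palindrome the first letter equals the last. *)
Lemma same_end_ext i j L : L <= i -> L <= j ->
  pal_end i.+1 L.+2 -> pal_end j.+1 L.+2 ->
  same_end i j L -> z i = z j -> same_end i.+1 j.+1 L.+2.
Proof.
move=> leLi leLj /(pal_endS leLi)[_ zi] /(pal_endS leLj)[_ zj] ij zE a b.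
move=> lta ltia ab.
have [ai | neqa] := eqVneq a i; first by rewrite ai (_ : b = j) ?zE //; lia.
have [aL | neqaL] := eqVneq a (i - L).
  by rewrite aL zi zE -zj; congr z; lia.
by apply: ij; lia.
Qed.

(* Reflection in the centre of the longer palindrome moves a shorter suffix
   palindrome to a prefix, hence to an earlier end. *)
Lemma pal_mirror i K L : 0 < L -> L <= K -> K <= i.+1 ->
  pal_end i K -> pal_end i L ->
  pal_end (i - (K - L)) L /\ same_end i (i - (K - L)) L.
Proof.
move=> L_gt0 leLK leKi pal_iK pal_iL.
have eqi : same_end i (i - (K - L)) L.
  move=> a b lta ltia ab.
  rewrite (pal_iL a (i + i - L - a)) ?(pal_iK b (i + i - L - a)) //; lia.
by split=> //; apply: pal_same_end eqi pal_iL; lia.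
Qed.

(** With [K] the longest suffix palindrome, this shows that a letter creates at most one new
    palindrome: any shorter one is reflected inside [K] to an earlier end. *)
Lemma longest_reflect i K L : K <= i.+2 -> pal_end i.+1 K ->
  L < K -> pal_end i.+1 L ->
  exists j, [/\ j <= i, L <= j.+1, pal_end j L & same_end i.+1 j L].
Proof.
move=> leK palK ltL palL; case: L ltL palL => [|L] ltL palL.
  by exists 0; split=> //; [exact: pal_end0 | exact: same_end0].
have [palj sj] := pal_mirror (ltn0Sn L) (ltnW ltL) leK palK palL.
by exists (i.+1 - (K - L.+1)); split=> //; lia.
Qed.

Variable S : nat.

(* Node [v > 0] stands for the palindrome with encoded length [len v] ending
   just before position [v - 1]; node 1 is the empty palindrome and node 0 the
   imaginary one. Unused nodes have [len v = 0]. Nodes are below [S]. *)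
Definition node (len : nat -> nat) (v : nat) : Prop :=
  v < S /\ (v = 0 \/ 0 < len v).

(* The tree of the first [i] letters; [edge v a = 0] when there is no edge. *)
Record eertree (i : nat) (len link : nat -> nat) (edge : nat -> nat -> nat)
    : Prop := Eertree {
  len0 : len 0 = 0;
  len1 : len 1 = 1;
  link0 : link 0 = 0;
  node_pal v : node len v ->
    [/\ v <= i.+1, len v <= v & pal_end v.-1 (len v)];
  node_complete j L : j <= i -> L <= j.+1 -> pal_end j L ->
    exists v, [/\ node len v, len v = L & same_end j v.-1 L];
  node_inj u v : node len u -> node len v -> len u = len v ->
    same_end u.-1 v.-1 (len u) -> u = v;
  node_link v : node len v -> v <> 0 ->
    [/\ node len (link v), len (link v) < len v,
        same_end v.-1 (link v).-1 (len (link v)) &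
        forall L, L < len v -> pal_end v.-1 L -> L <= len (link v)];
  node_edge v a u : v < S -> u <> 0 ->
    edge v a = u <->
    [/\ node len v, node len u, len u = (len v).+2, z u.-2 = a &
        same_end u.-2 v.-1 (len v)]
}.

(** * Walks along suffix links *)

Section Walk.
Variables (i : nat) (len link : nat -> nat) (edge : nat -> nat -> nat).
Hypothesis T : eertree i len link edge.

Lemma node_bounds v : node len v -> len v <= v.-1.+1.
Proof.
move=> /(node_pal T)[_ lev _].
by case: v lev => [|v] //; rewrite (len0 T).
Qed.

(* A suffix palindrome at [e] that is shorter than the node [q] occurring
   there is no longer than the link of [q]. *)
Lemma link_max e q L : node len q -> q <> 0 -> same_end e q.-1 (len q) ->
  len q <= e.+1 -> L < len q -> pal_end e L -> L <= len (link q).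
Proof.
move=> nq q0 eq lqe Lq pal_eL.
have [_ _ _] := node_link T nq q0; apply=> //.
have lq := node_bounds nq.
by apply: pal_same_end pal_eL; [lia | lia | apply: same_endW eq; lia].
Qed.

Lemma link_suffix e q : node len q -> q <> 0 -> same_end e q.-1 (len q) ->
  [/\ node len (link q), len (link q) < len q &
      same_end e (link q).-1 (len (link q))].
Proof.
move=> nq q0 eq; have [nl ltl sl _] := node_link T nq q0.
split=> //; apply: same_end_trans sl; last by apply: same_endW eq; lia.
by have := node_bounds nq; lia.
Qed.

Lemma edge_ext e q : node len q -> len q <= e -> same_end e q.-1 (len q) ->
  z (e - len q) = z e -> edge q (z e) <> 0 ->
  [/\ node len (edge q (z e)), len (edge q (z e)) = (len q).+2,
      pal_end e.+1 (len q).+2 &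
      same_end e.+1 (edge q (z e)).-1 (len q).+2].
Proof.
move=> nq lqe eq zE u0; set u := edge q (z e).
have [_ nu lu zu su] := (node_edge T (z e) nq.1 u0).1 erefl.
have [_ lqq pq] := node_pal T nq.
have bq := node_bounds nq; have bu := node_bounds nu.
have pe : pal_end e.+1 (len q).+2.
  apply/pal_endS => //; split=> //; apply: pal_same_end pq; try lia.
  by apply: same_end_sym eq; lia.
have [_ lqu pu] := node_pal T nu.
split=> //; have uE : u.-1 = u.-2.+1 by lia.
rewrite uE; rewrite uE lu in pu.
apply: same_end_ext => //; try lia.
apply: same_end_trans eq _; first lia.
by apply: same_end_sym su; lia.
Qed.

(** The extension is a palindrome with an occurrence in the prefix, so it has a node, and
    [node_edge] turns this node into an edge. Contrapositively, a missing edge certifies a new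
    palindrome. *)
Lemma edge_complete e q j : node len q -> len q <= e ->
  same_end e q.-1 (len q) -> z (e - len q) = z e ->
  j <= i -> (len q).+2 <= j.+1 -> same_end e.+1 j (len q).+2 ->
  edge q (z e) <> 0.
Proof.
move=> nq lqe eq zE lej leqj ej.
have [_ lqq pq] := node_pal T nq.
have bq := node_bounds nq.
have pe : pal_end e.+1 (len q).+2.
  apply/pal_endS => //; split=> //; apply: pal_same_end pq; try lia.
  by apply: same_end_sym eq; lia.
have pj : pal_end j (len q).+2 by apply: pal_same_end pe; try lia.
have [u [nu lu ju]] := node_complete T lej leqj pj.
have eu := same_end_trans leqj ej ju.
have bu := node_bounds nu; have uE : u.-1 = u.-2.+1 by lia.
rewrite uE in eu.
have u0 : u <> 0 by lia.
rewrite ((node_edge T (z e) nq.1 u0).2 _) //.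
split=> //; first by rewrite (same_end_last eu).
have su := same_endS eu.
by apply: same_end_trans eq; [lia | apply: same_end_sym su; lia].
Qed.

(** For the amortisation: the link of the child, stripped of both end letters, is a suffix
    palindrome shorter than [q], hence no longer than the link of [q]. *)
Lemma len_link_edge q a : node len q -> edge q a <> 0 ->
  len (link (edge q a)) <= (len (link q)).+2.
Proof.
move=> nq u0; have := (node_edge T a nq.1 u0).1 erefl.
move: (edge q a) u0 => u u0 [_ nu lu zu su].
have [nl ltl sl _] := node_link T nu u0.
have [_ ll pl] := node_pal T nl.
have bq := node_bounds nq; have bu := node_bounds nu.
have bl := node_bounds nl.
case E: (len (link u)) ltl => [|[|L]] // ltl.
have q0 : q <> 0 by move=> q0; move: (len0 T) lu ltl; rewrite q0; lia.
rewrite !ltnS; apply: (link_max (e := u.-2) nq) => //; try lia.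
have : pal_end u.-1 L.+2.
  rewrite -E; apply: pal_same_end pl; try lia.
  by apply: same_end_sym sl; lia.
have -> : u.-1 = u.-2.+1 by lia.
by case/pal_endS => //; lia.
Qed.

(** Loop invariant of the search for the longest palindrome ending at [e.+1]. The maximality
    concerns only suffix palindromes that extend, so it survives a failed comparison. *)
Definition suffix_walk e q : Prop :=
  [/\ node len q, len q <= e.+1, same_end e q.-1 (len q) &
      forall L, L <= e -> pal_end e.+1 L.+2 -> L <= len q].

Definition extends e q : bool := (len q <= e) && (z (e - len q) == z e).

Lemma extendsP e q : reflect (len q <= e /\ z (e - len q) = z e) (extends e q).
Proof. by apply: (iffP andP) => -[? /eqP]. Qed.

Lemma extends_pal e q : node len q -> same_end e q.-1 (len q) ->
  extends e q -> pal_end e.+1 (len q).+2.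
Proof.
move=> nq sq /extendsP[lqe zE]; apply/pal_endS => //; split=> //.
have [_ _ pq] := node_pal T nq; have bq := node_bounds nq.
by apply: pal_same_end pq; try lia; apply: same_end_sym sq; lia.
Qed.

Lemma suffix_walk_link e q : suffix_walk e q -> ~~ extends e q ->
  [/\ q <> 0, suffix_walk e (link q) & len (link q) < len q].
Proof.
move=> [nq lqe sq maxq] nmatch.
(* Node 0 compares the letter at [e] with itself, so the walk stops there at the latest. *)
have q0 : q <> 0.
  by move=> q0; move: nmatch; rewrite /extends q0 (len0 T) subn0 eqxx.
have [nl ll sl] := link_suffix nq q0 sq.
split=> //; split=> //; first by lia.
move=> L leL palL; have [palL' zL] := (pal_endS leL).1 palL.
apply: (link_max nq q0 sq) => //.
have := maxq L leL palL; rewrite leq_eqVlt => /orP[/eqP LE | //].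
by case/extendsP: nmatch; rewrite -LE.
Qed.

Lemma suffix_walk_longest e q L : suffix_walk e q -> L <= e.+2 ->
  pal_end e.+1 L -> L <= (len q).+2.
Proof.
move=> [_ _ _ maxq]; case: L => [|[|L]] // leL palL.
by rewrite !ltnS; apply: maxq.
Qed.

Lemma longest_suffix_walk e q : node len q -> len q <= e.+1 ->
  same_end e q.-1 (len q) ->
  (forall L, L <= e.+1 -> pal_end e L -> L <= len q) -> suffix_walk e q.
Proof.
move=> nq lq sq maxq; split=> // L leL /(pal_endS leL)[palL _].
by apply: maxq; first lia.
Qed.

(* The search for the link of the new node [z e] [q] [z e], along the links
   below [q]. *)
Definition link_walk e q r : Prop :=
  [/\ node len r, len r < len q, same_end e r.-1 (len r) &
      forall L, L < len q -> pal_end e.+1 L.+2 -> L <= len r].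

Lemma link_walk_start e q : suffix_walk e q -> len q <= e -> q <> 0 ->
  link_walk e q (link q).
Proof.
move=> [nq lqe sq maxq] lqe' q0; have [nl ll sl] := link_suffix nq q0 sq.
split=> // L ltL palL; apply: (link_max nq q0 sq) => //.
have leL : L <= e by lia.
exact: ((pal_endS leL).1 palL).1.
Qed.

Lemma link_walk_link e q r : len q <= e -> link_walk e q r ->
  z (e - len r) <> z e ->
  [/\ r <> 0, link_walk e q (link r) & len (link r) < len r].
Proof.
move=> lqe [nr lr sr maxr] zN.
have r0 : r <> 0 by move=> r0; apply: zN; rewrite r0 (len0 T) subn0.
have [nl ll sl] := link_suffix nr r0 sr.
split=> //; split=> //; first by lia.
move=> L ltL palL; have leL : L <= e by lia.
have [palL' zL] := (pal_endS leL).1 palL.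
apply: (link_max nr r0 sr) => //; first by lia.
have := maxr L ltL palL; rewrite leq_eqVlt => /orP[/eqP LE | //].
by case: zN; rewrite -LE.
Qed.

Definition new_link e q l : Prop :=
  [/\ node len l, len l < (len q).+2, same_end e.+1 l.-1 (len l) &
      forall L, L < (len q).+2 -> pal_end e.+1 L -> L <= len l].

(** The new node is then a single letter, whose longest proper palindromic suffix is empty. *)
Lemma new_link0 e : 1 < S -> new_link e 0 1.
Proof.
move=> S_gt1; split; rewrite ?(len0 T) ?(len1 T) //.
by split=> //; right; rewrite (len1 T).
exact: same_end1.
Qed.

(** The extension of [r] is shorter than that of [q], so by reflection it ended earlier and has a
    node. The program can therefore follow this edge without testing it. *)
Lemma link_walk_end q r : node len q -> extends i q ->
  same_end i q.-1 (len q) -> link_walk i q r ->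
  z (i - len r) = z i ->
  new_link i q (edge r (z i)) /\ len (edge r (z i)) = (len r).+2.
Proof.
move=> nq exq sq [nr lr sr maxr] zE; have palq := extends_pal nq sq exq.
have /extendsP[lqi _] := exq.
have lri : len r <= i by lia.
have exr : extends i r by apply/extendsP.
have palr := extends_pal nr sr exr.
have leK : (len q).+2 <= i.+2 by lia.
have ltK : (len r).+2 < (len q).+2 by lia.
have [j [lej leL pj sj]] := longest_reflect leK palq ltK palr.
have e0 := edge_complete nr lri sr zE lej leL sj.
have [nu lu pu su] := edge_ext nr lri sr zE e0.
split=> //; split; rewrite ?lu //.
move=> [|[|L]] // ltL palL; rewrite !ltnS; exact: maxr.
Qed.

End Walk.

(** * Building the tree letter by letter *)

Lemma eertree0 (len link : nat -> nat) (edge : nat -> nat -> nat) : 1 < S ->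
  (forall v, v < S -> len v = (v == 1)) -> (forall v, v < S -> link v = 0) ->
  (forall v a, v < S -> edge v a = 0) ->
  eertree 0 len link edge.
Proof.
move=> S_gt1 lenE linkE edgeE.
have nodeE v : node len v -> v <= 1 by case=> ltv [-> //|]; rewrite lenE //; lia.
have node0 : node len 0 by split; [lia | left].
have node1 : node len 1 by split=> //; right; rewrite lenE.
split; rewrite ?lenE ?linkE //; try lia.
- move=> v nv; have := nodeE _ nv; case: v nv => [|[|v]] // nv _.
    by rewrite lenE ?(ltnW S_gt1) //; split=> //; exact: pal_end0.
  by rewrite lenE //; split=> //; exact: pal_end1.
- move=> j [|[|L]] lej leL palj; last by lia.
    by exists 0; split=> //; [rewrite lenE //; lia | exact: same_end0].
  by exists 1; split=> //; [rewrite lenE | exact: same_end1].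
- move=> u v nu nv; move: (nodeE _ nu) (nodeE _ nv).
  by rewrite !lenE ?nu.1 ?nv.1 //; lia.
- move=> v nv v0; have v1 : v = 1 by have := nodeE _ nv; lia.
  have l00 : len 0 = 0 by rewrite lenE // (ltnW S_gt1).
  have l11 : len 1 = 1 by rewrite lenE.
  rewrite v1 linkE // l00 l11; split=> //.
- move=> v a u ltv u0; rewrite edgeE //; split=> [/esym // | [nv nu]].
  by have := nodeE _ nu; rewrite (lenE _ nu.1); lia.
Qed.


(** Shared by the two ways of reading a letter. A palindrome ending at [i.+1] is either the longest
    one, whose node is given, or has an earlier occurrence known to the old tree. *)
Lemma node_completeS i len link edge len' K j L :
  eertree i len link edge ->
  (forall v, node len v -> node len' v /\ len' v = len v) ->
  K <= i.+2 -> pal_end i.+1 K ->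
  (forall L, L <= i.+2 -> pal_end i.+1 L -> L <= K) ->
  (exists u, [/\ node len' u, len' u = K & same_end i.+1 u.-1 K]) ->
  j <= i.+1 -> L <= j.+1 -> pal_end j L ->
  exists v, [/\ node len' v, len' v = L & same_end j v.-1 L].
Proof.
move=> T len'E leK palK maxK exu lej leL palj.
have old j' : j' <= i -> L <= j'.+1 -> pal_end j' L -> same_end j j' L ->
    exists v, [/\ node len' v, len' v = L & same_end j v.-1 L].
  move=> lej' leL' palj' sj; have [v [nv lv sv]] := node_complete T lej' leL' palj'.
  have [nv' lv'] := len'E _ nv; exists v; split=> //; first by rewrite lv'.
  exact: same_end_trans sv.
move: lej; rewrite leq_eqVlt => /orP[/eqP jE | ltj]; last first.
  by apply: (old j) => //; exact: same_end_refl.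
move: leL palj old; rewrite {}jE => leL palL old.
have := maxK _ leL palL; rewrite leq_eqVlt => /orP[/eqP -> // | ltL].
have [j' [? ? ? ?]] := longest_reflect leK palK ltL palL.
exact: (old j').
Qed.

Lemma eertree_keep i len link edge u : eertree i len link edge ->
  node len u -> len u <= i.+2 -> same_end i.+1 u.-1 (len u) ->
  (forall L, L <= i.+2 -> pal_end i.+1 L -> L <= len u) ->
  eertree i.+1 len link edge.
Proof.
move=> T nu lu su maxu.
have [l0 l1 k0 npal ncomp ninj nlink nedge] := T; split=> //.
  by move=> v /npal[? ? ?]; split=> //; lia.
have [_ luu pu] := node_pal T nu; have bu := node_bounds T nu.
move=> j L lej leL palj; apply: (node_completeS T _ lu) => //.
- by apply: pal_same_end pu; [lia | lia | apply: same_end_sym su; lia].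
- by exists u.
Qed.

(** A node is numbered by the position that creates it, so no counter is kept and numbers may have
    gaps. Old numbers are at most [i.+1], which makes [i.+2] free. *)
Lemma eertree_insert i (len link len' link' : nat -> nat)
    (edge edge' : nat -> nat -> nat) q l :
  eertree i len link edge -> i.+2 < S ->
  node len q -> len q <= i -> same_end i q.-1 (len q) ->
  z (i - len q) = z i ->
  (forall L, L <= i -> pal_end i.+1 L.+2 -> L <= len q) ->
  edge q (z i) = 0 ->
  node len l -> len l < (len q).+2 -> same_end i.+1 l.-1 (len l) ->
  (forall L, L < (len q).+2 -> pal_end i.+1 L -> L <= len l) ->
  (forall v, v < S -> len' v = if v == i.+2 then (len q).+2 else len v) ->
  (forall v, v < S -> link' v = if v == i.+2 then l else link v) ->
  (forall v a, v < S ->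
    edge' v a = if (v == q) && (a == z i) then i.+2 else edge v a) ->
  eertree i.+1 len' link' edge'.
Proof.
move=> T ltiS nq lq sq zE maxq e0 nl ll sl maxl lenE linkE edgeE.
have nodeD v : node len v -> v <> i.+2.
  by move=> nv vE; have [] := node_pal T nv; rewrite vE ltnn.
have lenD v : node len v -> len' v = len v.
  by move=> nv; rewrite lenE ?nv.1 //; case: eqP (nodeD _ nv).
have node'W v : node len v -> node len' v.
  by move=> nv; split; [exact: nv.1 | rewrite lenD //; exact: nv.2].
have len'new : len' i.+2 = (len q).+2 by rewrite lenE // eqxx.
have node'new : node len' i.+2 by split=> //; right; rewrite len'new.
have nodeP v : node len' v -> node len v \/ v = i.+2.
  case=> ltv; rewrite lenE //; case: eqP => [|_ h]; [by right | by left].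
have [_ lqq pq] := node_pal T nq; have bq := node_bounds T nq.
have pnew : pal_end i.+1 (len q).+2.
  apply/pal_endS => //; split=> //; apply: pal_same_end pq; try lia.
  by apply: same_end_sym sq; lia.
(* The missing edge rules out earlier occurrences of the new palindrome. Injectivity of nodes and
   correctness of edges rest on this. *)
have fresh j : j <= i -> (len q).+2 <= j.+1 -> ~ same_end i.+1 j (len q).+2.
  by move=> lej lqj sj; exact: (edge_complete T nq lq sq zE lej lqj sj e0).
have freshv v : node len v -> len v = (len q).+2 ->
    ~ same_end i.+1 v.-1 (len q).+2.
  move=> nv lv; have bv := node_bounds T nv; have [? ? ?] := node_pal T nv.
  by apply: fresh; lia.
split.
- by rewrite lenE ?(len0 T) //; lia.
- by rewrite lenE ?(len1 T) //; lia.
- by rewrite linkE ?(link0 T) //; lia.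
- move=> v /nodeP[nv | ->]; last by rewrite len'new.
  by have [? ? ?] := node_pal T nv; rewrite lenD //; split=> //; lia.
- move=> j L; apply: (node_completeS T _ _ pnew) => //.
  + by move=> v nv; split; [exact: node'W | exact: lenD].
  + by move=> [|[|L']] //= ? ?; rewrite !ltnS; apply: maxq.
  + by exists i.+2; split=> //; exact: same_end_refl.
- move=> u v /nodeP[nu | ->] /nodeP[nv | ->] //.
  + by rewrite !lenD //; exact: (node_inj T nu nv).
  + rewrite len'new lenD // => lu su; case: (freshv u nu lu).
    have bu := node_bounds T nu; rewrite -lu.
    by apply: same_end_sym su; lia.
  + by rewrite len'new lenD // => lv sv; case: (freshv v nv (esym lv)).
- move=> v /nodeP[nv | ->] v0; last first.
    rewrite linkE // eqxx len'new lenD //=.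
    by split=> //; exact: node'W.
  have [? ? ? ?] := node_link T nv v0.
  rewrite linkE ?nv.1 //; case: eqP (nodeD _ nv) => // _ _.
  by rewrite !lenD //; split=> //; exact: node'W.
move=> v a u ltv u0; rewrite edgeE //; case: andP => [[/eqP-> /eqP->] | nva].
  split=> [<- | [_ /nodeP[nu | -> //]]].
    by rewrite len'new lenD //; split=> //; exact: node'W.
  rewrite !lenD // => lu zu su; case: (freshv u nu lu).
  have [? ? pu] := node_pal T nu; have bu := node_bounds T nu.
  have uE : u.-1 = u.-2.+1 by lia.
  rewrite uE; apply: same_end_ext => //; try lia.
    by rewrite -lu -uE.
  apply: same_end_trans sq _; first lia.
  by apply: same_end_sym su; lia.
rewrite (node_edge T a ltv u0); split=> [[nv nu] | [/nodeP[nv | vE]]].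
- by rewrite !lenD //; split=> //; exact: node'W.
- case/nodeP=> [nu | uE]; first by rewrite !lenD.
  rewrite uE len'new lenD //= => -[lqv] zia siv; case: nva.
  rewrite -zia eqxx; split=> //; apply/eqP; apply: (node_inj T) => //.
  have bv := node_bounds T nv; rewrite -lqv in siv *.
  by apply: same_end_trans sq; [lia | apply: same_end_sym siv; lia].
(* The new node has no outgoing edge: an old target would contain an earlier occurrence of the new
   palindrome. *)
- rewrite vE len'new => /nodeP[nu | ->]; last by rewrite len'new; lia.
  rewrite lenD // => lu _ su; have [? ? ?] := node_pal T nu.
  have bu := node_bounds T nu; case: (fresh u.-2); try lia.
  by apply: same_end_sym su; rewrite /=; lia.
Qed.


Lemma suffix_walk_init len : len 1 = 1 -> 1 < S -> suffix_walk len 0 1.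
Proof.
move=> l1 S_gt1; split; rewrite ?l1 //; last by move=> L; lia.
by split=> //; right; rewrite l1.
Qed.

Lemma suffix_walk_keep i len link edge q : eertree i len link edge ->
  suffix_walk len i q -> extends len i q -> edge q (z i) <> 0 ->
  [/\ eertree i.+1 len link edge, suffix_walk len i.+1 (edge q (z i)) &
      len (edge q (z i)) = (len q).+2].
Proof.
move=> T W exq e0; have [nq _ sq _] := W; have /extendsP[lqi zE] := exq.
have [nu lu _ su] := edge_ext T nq lqi sq zE e0.
have maxu L : L <= i.+2 -> pal_end i.+1 L -> L <= (len q).+2.
  exact: suffix_walk_longest.
split=> //; first by apply: (eertree_keep T nu); rewrite ?lu.
by apply: longest_suffix_walk; rewrite ?lu //; lia.
Qed.

Lemma suffix_walk_insert i (len link len' link' : nat -> nat)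
    (edge edge' : nat -> nat -> nat) q l :
  eertree i len link edge -> i.+2 < S ->
  suffix_walk len i q -> extends len i q -> edge q (z i) = 0 ->
  new_link len i q l ->
  (forall v, v < S -> len' v = if v == i.+2 then (len q).+2 else len v) ->
  (forall v, v < S -> link' v = if v == i.+2 then l else link v) ->
  (forall v a, v < S ->
    edge' v a = if (v == q) && (a == z i) then i.+2 else edge v a) ->
  eertree i.+1 len' link' edge' /\ suffix_walk len' i.+1 i.+2.
Proof.
move=> T ltiS W exq e0 [nl ll sl maxl] lenE linkE edgeE.
have [nq _ sq maxq] := W; have /extendsP[lqi zE] := exq.
split; first exact: (eertree_insert T ltiS nq lqi sq zE maxq e0 nl ll sl maxl).
have lnew : len' i.+2 = (len q).+2 by rewrite lenE // eqxx.
apply: longest_suffix_walk; rewrite ?lnew //.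
- by split=> //; right; rewrite lnew.
- exact: same_end_refl.
- by move=> L; apply: suffix_walk_longest.
Qed.

(** * Reading the second string with the tree frozen *)

Section Match.
Variables (n : nat) (len link : nat -> nat) (edge : nat -> nat -> nat).
Hypothesis T : eertree n len link edge.

Definition known j L : Prop :=
  exists u, [/\ node len u, len u = L & same_end j u.-1 L].

(** Turns a node into an occurrence within the first [n] letters, the form that [edge_complete]
    consumes. *)
Lemma known_inner e L : L <= e -> pal_end e.+1 L.+2 -> known e.+1 L.+2 ->
  exists j, [/\ j <= n, L.+2 <= j.+1 & same_end e.+1 j L.+2].
Proof.
move=> leL palL [u [nu lu su]]; have [? ? ?] := node_pal T nu.
have bu := node_bounds T nu.
by exists u.-1; split=> //; lia.
Qed.

(* In the second string, starting at position [n], only the palindromes that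
   have a node are followed. *)
Definition match_walk e q : Prop :=
  [/\ node len q, n + len q <= e.+1, same_end e q.-1 (len q) &
      forall L, n + L <= e -> pal_end e.+1 L.+2 -> known e.+1 L.+2 ->
        L <= len q].

(** The first test keeps the left letter at or after position [n], so that no palindrome crosses the
    border between the strings. *)
Definition match_extends e q : bool :=
  [&& n + len q <= e, z (e - len q) == z e & edge q (z e) != 0].

Lemma match_walk_init : 1 < S -> match_walk n 1.
Proof.
move=> S_gt1; split; rewrite ?(len1 T) ?addn1 //; last by move=> L; lia.
  by split=> //; right; rewrite (len1 T).
exact: same_end1.
Qed.

Lemma match_walk_max e q L : match_walk e q -> ~~ match_extends e q ->
  n + L <= e -> pal_end e.+1 L.+2 -> known e.+1 L.+2 -> L < len q.
Proof.
move=> [nq lqe sq maxq] nmatch leL palL knownL.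
have := maxq L leL palL knownL; rewrite leq_eqVlt => /orP[/eqP LE | //].
have leLe : L <= e by lia.
have [_ zL] := (pal_endS leLe).1 palL; case/negP: nmatch.
have [j [lej leLj sj]] := known_inner leLe palL knownL.
subst L; rewrite /match_extends leL zL eqxx; apply/eqP.
exact: (edge_complete T nq leLe sq zL lej leLj sj).
Qed.

Lemma match_walk_link e q : match_walk e q -> ~~ match_extends e q ->
  q <> 0 -> match_walk e (link q) /\ len (link q) < len q.
Proof.
move=> W nmatch q0; have [nq lqe sq maxq] := W.
have [nl ll sl] := link_suffix T nq q0 sq.
split=> //; split=> //; first by lia.
move=> L leL palL knownL; have leLe : L <= e by lia.
apply: (link_max T nq q0 sq); first by lia.
  exact: (match_walk_max W nmatch).
exact: ((pal_endS leLe).1 palL).1.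
Qed.

(** Closure under stripping enters here: the inner part of a known palindrome is known, so
    maximality among known suffix palindromes suffices to start the next walk. *)
Lemma longest_match_walk e q : node len q -> n + len q <= e.+1 ->
  same_end e q.-1 (len q) ->
  (forall L, n + L <= e.+1 -> pal_end e L -> known e L -> L <= len q) ->
  match_walk e q.
Proof.
move=> nq lq sq maxq; split=> // L leL palL knownL.
have leLe : L <= e by lia.
have [palL' _] := (pal_endS leLe).1 palL.
have [j [lej leLj sj]] := known_inner leLe palL knownL.
apply: maxq; [lia | exact: palL' |].
have sj' : same_end e j.-1 L.
  by apply: same_endS; have -> : j.-1.+1 = j by lia.
have palj : pal_end j.-1 L by apply: pal_same_end sj' palL'; lia.
have [||v [nv lv sv]] := node_complete T _ _ palj; [lia | lia |].
by exists v; split=> //; apply: same_end_trans sv; first lia.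
Qed.

(** Node 0 can fail only through a missing edge: the letter does not occur in the first string, and
    the walk restarts from the empty palindrome. *)
Lemma match_walk_root e : 1 < S -> match_walk e 0 -> ~~ match_extends e 0 ->
  n <= e -> match_walk e.+1 1 /\
  forall L, n + L <= e.+2 -> pal_end e.+1 L -> known e.+1 L -> L <= 1.
Proof.
move=> S_gt1 W nmatch lene.
have max1 L : n + L <= e.+2 -> pal_end e.+1 L -> known e.+1 L -> L <= 1.
  case: L => [|[|L]] // leL palL knownL.
  have leL' : n + L <= e by lia.
  by have := match_walk_max W nmatch leL' palL knownL; rewrite (len0 T).
split=> //; apply: longest_match_walk; rewrite ?(len1 T) //; try lia.
  by split=> //; right; rewrite (len1 T).
exact: same_end1.
Qed.

Lemma match_walk_edge e q : match_walk e q -> match_extends e q ->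
  [/\ match_walk e.+1 (edge q (z e)), len (edge q (z e)) = (len q).+2,
      pal_end e.+1 (len q).+2, known e.+1 (len q).+2 &
      forall L, n + L <= e.+2 -> pal_end e.+1 L -> known e.+1 L ->
        L <= (len q).+2].
Proof.
move=> [nq lqe sq maxq] /and3P[leq /eqP zE /eqP e0].
have leqe : len q <= e by lia.
have [nu lu pu su] := edge_ext T nq leqe sq zE e0.
have maxu L : n + L <= e.+2 -> pal_end e.+1 L -> known e.+1 L ->
    L <= (len q).+2.
  by case: L => [|[|L]] // leL palL knownL; rewrite !ltnS; apply: maxq => //; lia.
split=> //; last by exists (edge q (z e)).
by apply: longest_match_walk; rewrite ?lu //; lia.
Qed.

(** The condition [n + L <= j.+1] places the palindrome entirely in the second string. *)
Definition best e L : Prop :=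
  (exists j, [/\ n <= j <= e, n + L <= j.+1, pal_end j L & known j L]) /\
  (forall j K, n <= j <= e -> n + K <= j.+1 -> pal_end j K -> known j K ->
    K <= L).

Lemma best_init : 1 < S -> best n 1.
Proof.
move=> S_gt1; split=> [|j K]; last by lia.
exists n; split; rewrite ?leqnn ?addn1 //; first exact: pal_end1.
exists 1; split; rewrite ?(len1 T) //; last exact: same_end1.
by split=> //; right; rewrite (len1 T).
Qed.

Lemma best_step e L K : best e L -> n <= e ->
  n + K <= e.+2 -> pal_end e.+1 K -> known e.+1 K ->
  (forall L, n + L <= e.+2 -> pal_end e.+1 L -> known e.+1 L -> L <= K) ->
  best e.+1 (maxn L K).
Proof.
move=> [[j [lej lL palL knownL]] maxL] lene lK palK knownK maxK; split.
  case: (leqP L K) => _; [exists e.+1 | exists j]; split=> //; lia.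
move=> k J lek lJ palJ knownJ; rewrite leq_max.
have [kE | kN] := eqVneq k e.+1.
  by rewrite [J <= K]maxK ?orbT -?kE.
by rewrite (maxL k) //; lia.
Qed.

Lemma best_keep e L : best e L -> 0 < L ->
  (forall L, n + L <= e.+2 -> pal_end e.+1 L -> known e.+1 L -> L <= 1) ->
  best e.+1 L.
Proof.
move=> [[j [lej lL palL knownL]] maxL] L_gt0 max1; split.
  by exists j; split=> //; lia.
move=> k J lek lJ palJ knownJ; have [kE | kN] := eqVneq k e.+1.
  by apply: leq_trans L_gt0; apply: max1; rewrite -?kE.
by apply: (maxL k) => //; lia.
Qed.

End Match.

End Palindromes.

(** * The program *)

(* R0 = |x|, R1 = N = |x| + |y|, R2 = 1, R3 = S = N + 2, R4 the current
   position, R5 the current node, R6 the maximum (while reading y), R7 the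
   current letter, R13 = 0. Cell [S + v] holds the length of node [v], cell
   [2 S + v] its link, and cell [(a + 2) S + v] its edge labelled [a >= 1].
   The numbers in comments are the jump targets. *)
Definition lpalcf_program : program := [::
  Op Plus 1 0 1; Const 2 1; Op Plus 3 1 2; Op Plus 3 3 2; Const 5 1;
  Op Plus 10 3 5; Write 10 2;
  (* 7: next letter of x *)
  JumpEq 4 0 51; Read 7 4;
  (* 9: does the suffix palindrome R5 extend *)
  Op Plus 10 3 5; Read 9 10; JumpLt 4 9 15; Op Minus 11 4 9; Read 11 11;
  JumpEq 11 7 18;
  (* 15: follow the link *)
  Op Plus 10 10 3; Read 5 10; Jump 9;
  (* 18: look up the edge *)
  Op Plus 10 10 3; Op Times 11 7 3; Op Plus 11 11 10; Read 12 11;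
  JumpEq 12 13 26; Op Plus 5 12 13; Op Plus 4 4 2; Jump 7;
  (* 26: no edge; find the link R12 of the new node *)
  Const 12 1; JumpEq 5 13 40; Read 6 10;
  (* 29: does the suffix palindrome R6 extend *)
  Op Plus 10 3 6; Read 12 10; Op Minus 12 4 12; Read 12 12; Op Plus 10 10 3;
  JumpEq 12 7 37; Read 6 10; Jump 29;
  (* 37: it does; its edge leads to the link *)
  Op Times 12 7 3; Op Plus 12 12 10; Read 12 12;
  (* 40: insert the new node *)
  Op Plus 5 4 2; Op Plus 5 5 2; Write 11 5; Op Plus 10 3 5; Op Plus 9 9 2;
  Op Plus 9 9 2; Write 10 9; Op Plus 10 10 3; Write 10 12; Op Plus 4 4 2;
  Jump 7;
  (* 51: start reading y *)
  Const 5 1; Const 6 1;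
  (* 53: next letter of y *)
  JumpEq 4 1 81; Read 7 4;
  (* 55: does the suffix palindrome R5 extend inside y *)
  Op Plus 10 3 5; Read 9 10; Op Plus 11 9 0; JumpLt 4 11 62; Op Minus 11 4 9;
  Read 11 11; JumpEq 11 7 66;
  (* 62: follow the link, or restart from the empty palindrome *)
  JumpEq 5 13 78; Op Plus 10 10 3; Read 5 10; Jump 55;
  (* 66: look up the edge, update the maximum *)
  Op Plus 11 10 3; Op Times 12 7 3; Op Plus 11 12 11; Read 11 11;
  JumpEq 11 13 62; Op Plus 5 11 13; Op Plus 9 9 2; Op Plus 9 9 2;
  Op Plus 4 4 2; JumpLt 9 6 53; Op Plus 6 9 13; Jump 53;
  (* 78: restart *)
  Const 5 1; Op Plus 4 4 2; Jump 53;
  (* 81: decode the length *)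
  Op Minus 0 6 2].

(** * Reachability with a bound on the number of steps *)

Definition reach (w K : nat) (s : state) (Q : state -> Prop) : Prop :=
  exists2 t, t <= K & Q (iter t (step w lpalcf_program) s).

Section Reach.
Variable w : nat.

Lemma reach0 K s (Q : state -> Prop) : Q s -> reach w K s Q.
Proof. by exists 0. Qed.

Lemma reachW K K' s (Q : state -> Prop) : K <= K' ->
  reach w K s Q -> reach w K' s Q.
Proof. by move=> leK [t leT Qt]; exists t; first exact: leq_trans leK. Qed.

Lemma reach_trans K K' s (Q Q' : state -> Prop) :
  reach w K s Q -> (forall s, Q s -> reach w K' s Q') -> reach w (K + K') s Q'.
Proof.
move=> [t leT Qt] QQ'; have [t' leT' Qt'] := QQ' _ Qt.
by exists (t' + t); [lia | rewrite iterD].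
Qed.

(** The amortisation principle: [m] is a potential that drops with every stretch of at most [K]
    instructions. *)
Lemma reach_descent K (I : nat -> state -> Prop) (Q : state -> Prop) :
  (forall m s, I m s -> reach w K s (fun s' => Q s' \/ exists2 m', m' < m & I m' s')) ->
  forall m s, I m s -> reach w (K * m.+1) s Q.
Proof.
move=> stepI; elim/ltn_ind=> m IHm s /stepI Is.
rewrite mulnS; apply: (reach_trans Is) => s' [Qs | [m' ltm Im]].
  exact: reach0.
by apply: reachW (IHm _ ltm _ Im); rewrite leq_mul2l ltm orbT.
Qed.

Variables (K l : nat) (R M : nat -> nat) (Q : state -> Prop).

Lemma reachS i : onth lpalcf_program l = Some i ->
  reach w K (exec w i (State l R M)) Q -> reach w K.+1 (State l R M) Q.
Proof.
by move=> li [t leT Qt]; exists t.+1 => //; rewrite iterSr /step /= li.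
Qed.

Lemma reach_const r a : onth lpalcf_program l = Some (Const r a) ->
  a < 2 ^ w -> reach w K (State l.+1 (upd R r a) M) Q ->
  reach w K.+1 (State l R M) Q.
Proof. by move=> /reachS lS lta h; apply: lS; rewrite /= /to_word modn_small. Qed.

Lemma reach_plus r a b x y : onth lpalcf_program l = Some (Op Plus r a b) ->
  R a = x -> R b = y -> x + y < 2 ^ w ->
  reach w K (State l.+1 (upd R r (x + y)) M) Q -> reach w K.+1 (State l R M) Q.
Proof.
move=> /reachS lS ax bY lt h; apply: lS.
by rewrite /= ax bY /eval_binop /to_word modn_small.
Qed.

Lemma reach_times r a b x y : onth lpalcf_program l = Some (Op Times r a b) ->
  R a = x -> R b = y -> x * y < 2 ^ w ->
  reach w K (State l.+1 (upd R r (x * y)) M) Q -> reach w K.+1 (State l R M) Q.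
Proof.
move=> /reachS lS ax bY lt h; apply: lS.
by rewrite /= ax bY /eval_binop /to_word modn_small.
Qed.

Lemma reach_minus r a b x y : onth lpalcf_program l = Some (Op Minus r a b) ->
  R a = x -> R b = y -> y <= x -> x < 2 ^ w ->
  reach w K (State l.+1 (upd R r (x - y)) M) Q -> reach w K.+1 (State l R M) Q.
Proof.
move=> /reachS lS ax bY le lt h; apply: lS.
have E : x + 2 ^ w - y = x - y + 2 ^ w by lia.
by rewrite /= ax bY /eval_binop /to_word E modnDr modn_small //; lia.
Qed.

Lemma reach_read r a x v : onth lpalcf_program l = Some (Read r a) ->
  R a = x -> M x = v ->
  reach w K (State l.+1 (upd R r v) M) Q -> reach w K.+1 (State l R M) Q.
Proof. by move=> /reachS lS ax xv h; apply: lS; rewrite /= ax xv. Qed.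

Lemma reach_write a b x v : onth lpalcf_program l = Some (Write a b) ->
  R a = x -> R b = v ->
  reach w K (State l.+1 R (upd M x v)) Q -> reach w K.+1 (State l R M) Q.
Proof. by move=> /reachS lS ax xv h; apply: lS; rewrite /= ax xv. Qed.

Lemma reach_jump l' : onth lpalcf_program l = Some (Jump l') ->
  reach w K (State l' R M) Q -> reach w K.+1 (State l R M) Q.
Proof. by move=> /reachS lS h; apply: lS. Qed.

Lemma reach_jumplt a b x y l' : onth lpalcf_program l = Some (JumpLt a b l') ->
  R a = x -> R b = y ->
  (x < y -> reach w K (State l' R M) Q) ->
  (y <= x -> reach w K (State l.+1 R M) Q) -> reach w K.+1 (State l R M) Q.
Proof.
by move=> /reachS lS ax bY lt ge; apply: lS; rewrite /= ax bY; case: ltnP.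
Qed.

Lemma reach_jumpeq a b x y l' : onth lpalcf_program l = Some (JumpEq a b l') ->
  R a = x -> R b = y ->
  (x = y -> reach w K (State l' R M) Q) ->
  (x <> y -> reach w K (State l.+1 R M) Q) -> reach w K.+1 (State l R M) Q.
Proof.
by move=> /reachS lS ax bY eq ne; apply: lS; rewrite /= ax bY; case: eqP.
Qed.

End Reach.

Lemma updE f i v j : upd f i v j = if j == i then v else f j.
Proof. by []. Qed.

Arguments upd : simpl never.

Ltac register :=
  rewrite ?updE /=;
  match goal with H : ?R ?k = _ |- ?R ?k = _ => exact H | |- _ => reflexivity end.
Ltac do_const := eapply reach_const; [reflexivity | lia | ].
Ltac do_plus := eapply reach_plus; [reflexivity | register | register | lia | ].
Ltac do_times := eapply reach_times; [reflexivity | register | register | lia | ].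
Ltac do_minus := eapply reach_minus; [reflexivity | register | register | lia | lia | ].
Ltac do_read v := eapply (@reach_read _ _ _ _ _ _ _ _ _ v); [reflexivity | register | | ].
Ltac do_write := eapply reach_write; [reflexivity | register | register | ].
Ltac do_jump := eapply reach_jump; [reflexivity | ].
Ltac do_jumplt := eapply reach_jumplt; [reflexivity | register | register | | ].
Ltac do_jumpeq := eapply reach_jumpeq; [reflexivity | register | register | | ].

(** * Memory layout, loop invariants and running time *)

Definition len_of (S : nat) (M : nat -> nat) v := M (S + v).
Definition link_of (S : nat) (M : nat -> nat) v := M (S + v + S).
(* Row 0 of this table would be the row of links. *)
Definition edge_of (S : nat) (M : nat -> nat) v a :=
  if a is 0 then 0 else M (a * S + (S + v + S)).

Lemma edge_ofE S M v a : 0 < a -> edge_of S M v a = M (a * S + (S + v + S)).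
Proof. by case: a. Qed.

Section Run.
Variables (w n N : nat) (z : nat -> nat).
Let S := N.+2.
Hypothesis le_nN : n <= N.
Hypothesis z_gt0 : forall j, j < N -> 0 < z j.
Hypothesis z_out : forall j, N <= j -> z j = 0.
(** Every address of an edge labelled [a] is below [(a + 3) * S], so no address computation wraps
    around. *)
Hypothesis z_word : forall j, (z j + 4) * S < 2 ^ w.

Record frame (R M : nat -> nat) : Prop := Frame {
  frame0 : R 0 = n;
  frame1 : R 1 = N;
  frame2 : R 2 = 1;
  frame3 : R 3 = S;
  frame13 : R 13 = 0;
  frame_input j : j < N -> M j = z j
}.

Definition tree M i := eertree z S i (len_of S M) (link_of S M) (edge_of S M).

(** Potential while building. The two lengths pay for the links followed in the two walks; each
    grows by at most 2 per letter, which the 8 per unread letter covers. The rest is reserved for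
    the second string. *)
Definition build_cost M i q :=
  8 * (n - i) + len_of S M q + len_of S M (link_of S M q) + 8 * (N - n) + 10.

Definition match_cost M i q := 8 * (N - i) + len_of S M q.

(** One constructor per loop head, with [m] bounding the potential. The additive constants make it
    drop also when moving from one head to another. *)
Inductive inv (m : nat) : state -> Prop :=
| InvBuild R M i q of frame R M & R 4 = i & R 5 = q & i <= n & tree M i
    & suffix_walk z S (len_of S M) i q & build_cost M i q + 3 <= m :
    inv m (State 7 R M)
| InvSuffix R M i q of frame R M & R 4 = i & R 5 = q & R 7 = z i & i < n
    & tree M i & suffix_walk z S (len_of S M) i q & build_cost M i q + 2 <= m :
    inv m (State 9 R M)
| InvLink R M i q r of frame R M & R 4 = i & R 6 = r & R 7 = z i
    & R 9 = len_of S M q & R 11 = z i * S + (S + q + S) & i < n & tree M i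
    & suffix_walk z S (len_of S M) i q & extends z (len_of S M) i q
    & edge_of S M q (z i) = 0 & link_walk z S (len_of S M) i q r
    & 8 * (n - i) + len_of S M q + len_of S M r + 8 * (N - n) + 11 <= m :
    inv m (State 29 R M)
| InvMatch R M i q of frame R M & R 4 = i & R 5 = q & n <= i <= N & tree M n
    & match_walk z S n (len_of S M) i q & best z S n (len_of S M) i (R 6)
    & 0 < R 6 & match_cost M i q + 3 <= m :
    inv m (State 53 R M)
| InvMatchSuffix R M i q of frame R M & R 4 = i & R 5 = q & R 7 = z i
    & n <= i < N & tree M n
    & match_walk z S n (len_of S M) i q & best z S n (len_of S M) i (R 6)
    & 0 < R 6 & match_cost M i q + 2 <= m :
    inv m (State 55 R M).

Definition final (s : state) : Prop :=
  halted lpalcf_program s /\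
  exists2 M, tree M n & best z S n (len_of S M) N (output s).+1.

Definition progress m s := final s \/ exists2 m', m' < m & inv m' s.

Lemma S_word : 4 * S < 2 ^ w.
Proof. by apply: leq_ltn_trans (z_word N); rewrite z_out. Qed.

Lemma z_word_lin j : z j * S + 4 * S < 2 ^ w.
Proof. by rewrite -mulnDl. Qed.

Lemma z_row j : j < N -> S <= z j * S.
Proof. by move=> /z_gt0; case: (z j) => // a _; rewrite mulSn leq_addr. Qed.

Lemma frame_upd R M r v : 3 < r -> r != 13 -> frame R M -> frame (upd R r v) M.
Proof.
move=> r3 r13 [h0 h1 h2 h3 h13 hM].
by split=> //; rewrite updE; case: eqP => // rE; rewrite -rE in r3 r13.
Qed.

Lemma progress_inv m m' s : m' < m -> inv m' s -> progress m s.
Proof. by right; exists m'. Qed.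

Lemma new_node_frame R M i q l : frame R M -> i < n -> q < S ->
  frame R (upd (upd (upd M (z i * S + (S + q + S)) i.+2)
    (S + i.+2) (len_of S M q).+2) (S + i.+2 + S) l).
Proof.
move=> [h0 h1 h2 h3 h13 hM] lti ltq; split=> // j ltj; rewrite !updE.
by rewrite !ifN ?hM //; rewrite /S in ltq *; lia.
Qed.

Lemma new_node_tables M i q l (M' := upd (upd (upd M (z i * S + (S + q + S)) i.+2)
    (S + i.+2) (len_of S M q).+2) (S + i.+2 + S) l) : i < n -> q < S ->
  [/\ forall v, v < S -> len_of S M' v =
        if v == i.+2 then (len_of S M q).+2 else len_of S M v,
      forall v, v < S -> link_of S M' v = if v == i.+2 then l else link_of S M v &
      forall v a, v < S -> edge_of S M' v a =
        if (v == q) && (a == z i) then i.+2 else edge_of S M v a].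
Proof.
move=> lti ltq; have ltiN : i < N by lia.
have row := z_row ltiN; have zi := z_gt0 ltiN.
split=> [v ltv | v ltv | v a ltv]; rewrite /M'.
- rewrite /len_of !updE ifN ?eqn_add2l; last by lia.
  by case: eqP => // _; rewrite ifN //; lia.
- rewrite /link_of !updE eqn_add2r eqn_add2l.
  by case: eqP => // _; rewrite !ifN //; lia.
case: a => [|a]; first by rewrite /= andbC; case: (z i) zi.
rewrite /= !updE.
have lea : S <= a.+1 * S by rewrite mulSn leq_addr.
rewrite ifN; last by lia.
rewrite ifN; last by lia.
suff -> : (a.+1 * S + (S + v + S) == z i * S + (S + q + S)) =
  (v == q) && (a.+1 == z i) by [].
apply/eqP/andP=> [E | [/eqP-> /eqP-> //]].
(* Quotient and remainder by [S] recover letter and node, so distinct entries have distinct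
   addresses. *)
have E' : a.+1 * S + v = z i * S + q by lia.
have := congr1 (divn^~ S) E'; have := congr1 (modn^~ S) E'.
by rewrite !modnMDl !divnMDl // !modn_small // !divn_small // !addn0 => -> ->.
Qed.

Lemma step_fin m R M i q l : frame R M -> R 4 = i -> R 9 = len_of S M q ->
  R 11 = z i * S + (S + q + S) -> R 12 = l -> i < n -> tree M i ->
  suffix_walk z S (len_of S M) i q -> extends z (len_of S M) i q ->
  edge_of S M q (z i) = 0 -> new_link z S (len_of S M) i q l ->
  8 * (n - i) + len_of S M q + len_of S M l + 8 * (N - n) + 8 <= m ->
  reach w 20 (State 40 R M) (progress m).
Proof.
move=> F r4 r9 r11 r12 lti T W exq e0 L lem.
have [h0 h1 h2 h3 h13 hM] := F; have Sw := S_word.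
have SE : S = N.+2 by [].
have [nq _ _ _] := W; have bq := node_bounds T nq; have ltq := nq.1.
have [nl _ _ _] := L; have ltl := nl.1.
do 2 do_plus; do_write; do 3 do_plus; do_write; do_plus; do_write; do_plus.
do_jump; apply: reach0.
have -> : i + 1 + 1 = i.+2 by lia.
have -> : len_of S M q + 1 + 1 = (len_of S M q).+2 by lia.
have [tl tk te] := new_node_tables M l lti ltq.
have ltiS : i.+2 < S by rewrite SE; lia.
have [T' W'] := suffix_walk_insert T ltiS W exq e0 L tl tk te.
apply: (@progress_inv _ m.-1); first lia.
apply: InvBuild (T') (W') _; rewrite ?updE //=.
- by rewrite /=; repeat apply: frame_upd => //; apply: new_node_frame.
- by lia.
rewrite /build_cost tk // eqxx tl // eqxx tl //.
have [lel _ _] := node_pal T nl.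
by rewrite ifN; lia.
Qed.

Lemma step_link m s R M i q r : s = State 29 R M -> frame R M -> R 4 = i ->
  R 6 = r -> R 7 = z i -> R 9 = len_of S M q ->
  R 11 = z i * S + (S + q + S) -> i < n -> tree M i ->
  suffix_walk z S (len_of S M) i q -> extends z (len_of S M) i q ->
  edge_of S M q (z i) = 0 -> link_walk z S (len_of S M) i q r ->
  8 * (n - i) + len_of S M q + len_of S M r + 8 * (N - n) + 11 <= m ->
  reach w 40 s (progress m).
Proof.
move=> -> F r4 r6 r7 r9 r11 lti T W exq e0 L lem.
have [h0 h1 h2 h3 h13 hM] := F; have Sw := S_word; have zw := z_word_lin i.
have SE : S = N.+2 by [].
have ltiN : i < N by lia.
have [nq _ sq _] := W; have /extendsP[lqi _] := exq.
have [nr lr _ _] := L; have ltr := nr.1.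
do_plus; do_read (len_of S M r) => //; do_minus.
do_read (z (i - len_of S M r)); first by rewrite hM //; lia.
do_plus; do_jumpeq => [zE | zN].
  have [L' lL'] := link_walk_end T nq exq sq L zE.
  do_times; do_plus; do_read (edge_of S M r (z i)).
    by rewrite edge_ofE // z_gt0.
  apply: (@reachW _ 20) => //.
  apply: step_fin (T) (W) exq e0 L' _ => //; rewrite ?updE //=.
  by rewrite lL'; lia.
have [r0 L' ltl] := link_walk_link T lqi L zN.
do_read (link_of S M r) => //; do_jump; apply: reach0.
apply: (@progress_inv _ m.-1); first lia.
by apply: InvLink (T) (W) exq e0 L' _; rewrite ?updE //=; lia.
Qed.

Lemma step_suffix m s R M i q : s = State 9 R M -> frame R M -> R 4 = i ->
  R 5 = q -> R 7 = z i -> i < n -> tree M i ->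
  suffix_walk z S (len_of S M) i q -> build_cost M i q + 2 <= m ->
  reach w 40 s (progress m).
Proof.
move=> -> F r4 r5 r7 lti T W lem.
have [h0 h1 h2 h3 h13 hM] := F; have Sw := S_word; have zw := z_word_lin i.
have SE : S = N.+2 by [].
have ltiN : i < N by lia.
have zi := z_gt0 ltiN; have [nq lqe sq _] := W; have ltq := nq.1.
(* Two failures lead to address 15: no letter on the left, or a mismatch. *)
have walk_on R' : R' 10 = S + q -> frame R' M -> R' 4 = i -> R' 7 = z i ->
    ~~ extends z (len_of S M) i q -> reach w 3 (State 15 R' M) (progress m).
  move=> r10 F' r4' r7' exN; have [g0 g1 g2 g3 g13 gM] := F'.
  have [q0 W' ltl] := suffix_walk_link T W exN.
  do_plus; do_read (link_of S M q) => //; do_jump; apply: reach0.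
  apply: (@progress_inv _ m.-1); first by lia.
  apply: InvSuffix (T) (W') _; rewrite ?updE //=.
  (* The second length in the potential must not grow. Equality occurs at node 0, which is its own
     link. *)
  have lll : len_of S M (link_of S M (link_of S M q)) <= len_of S M (link_of S M q).
    have [-> | /eqP k0] := eqVneq (link_of S M q) 0; first by rewrite (link0 T).
    have [nk _ _ _] := W'.
    by have [_ ltk _ _] := node_link T nk k0; lia.
  by move: lem; rewrite /build_cost; lia.
do_plus; do_read (len_of S M q) => //; do_jumplt => [ltlq | leqi].
  apply: (@reachW _ 3) => //.
  apply: walk_on; rewrite ?updE //=.
  by rewrite /extends leqNgt ltlq.
do_minus; do_read (z (i - len_of S M q)); first by rewrite hM //; lia.
do_jumpeq => [zE | zN]; last first.
  apply: (@reachW _ 3) => //.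
  apply: walk_on; rewrite ?updE //=.
  by rewrite /extends leqi; apply/eqP.
have exq : extends z (len_of S M) i q by apply/extendsP.
do_plus; do_times; do_plus; do_read (edge_of S M q (z i)).
  by rewrite edge_ofE.
do_jumpeq => [e0 | e0]; last first.
  have [T' W' lE] := suffix_walk_keep T W exq e0.
  have [nu _ _ _] := W'; have ltu := nu.1.
  have := len_link_edge T nq e0 => llE.
  do 2 do_plus; do_jump; apply: reach0.
  rewrite addn0 addn1.
  apply: (@progress_inv _ m.-1); first by lia.
  apply: InvBuild (T') (W') _; rewrite ?updE //=.
  by move: lem; rewrite /build_cost lE; lia.
do_const; do_jumpeq => [q0 | q0].
  apply: (@reachW _ 20) => //.
  have L : new_link z S (len_of S M) i q 1.
    by rewrite q0; apply: (new_link0 T); rewrite SE.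
  apply: step_fin (T) (W) exq e0 L _; rewrite ?updE //=.
  move: lem; rewrite /build_cost (len1 T); lia.
have L := link_walk_start T W leqi q0.
do_read (link_of S M q) => //; apply: reach0.
apply: (@progress_inv _ m.-1); first by lia.
apply: InvLink (T) (W) exq e0 L _; rewrite ?updE //=.
by move: lem; rewrite /build_cost; lia.
Qed.

Lemma step_build m s R M i q : s = State 7 R M -> frame R M -> R 4 = i ->
  R 5 = q -> i <= n -> tree M i -> suffix_walk z S (len_of S M) i q ->
  build_cost M i q + 3 <= m -> reach w 40 s (progress m).
Proof.
move=> -> F r4 r5 lei T W lem.
have [h0 h1 h2 h3 h13 hM] := F; have Sw := S_word.
have SE : S = N.+2 by [].
do_jumpeq => [iE | iN].
  rewrite iE in r4 T; do 2 do_const; apply: reach0.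
  apply: (@progress_inv _ m.-1); first by lia.
  have S_gt1 : 1 < S by rewrite SE.
  apply: (InvMatch (i := n) (q := 1)) (T) _ _ _ _; rewrite ?updE //= ?leqnn //.
  - exact: (match_walk_init T).
  - exact: (best_init T).
  by move: lem; rewrite /build_cost /match_cost (len1 T); lia.
have lti : i < n by lia.
do_read (z i); first by rewrite hM //; lia.
apply: reach0; apply: (@progress_inv _ m.-1); first by lia.
by apply: InvSuffix (T) (W) _; rewrite ?updE //=; lia.
Qed.

Lemma step_match_suffix m s R M i q : s = State 55 R M -> frame R M ->
  R 4 = i -> R 5 = q -> R 7 = z i -> n <= i < N -> tree M n ->
  match_walk z S n (len_of S M) i q -> best z S n (len_of S M) i (R 6) ->
  0 < R 6 -> match_cost M i q + 2 <= m -> reach w 40 s (progress m).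
Proof.
move=> -> F r4 r5 r7 /andP[lei lti] T W B ans0 lem.
have [h0 h1 h2 h3 h13 hM] := F; have Sw := S_word; have zw := z_word_lin i.
have SE : S = N.+2 by []; have S_gt1 : 1 < S by rewrite SE.
have zi := z_gt0 lti; have [nq lqe sq _] := W; have ltq := nq.1.
(* Three failures lead to address 62: the border of the second string, a mismatch, or a missing
   edge. *)
have walk_on R' : R' 10 = S + q -> frame R' M -> R' 4 = i -> R' 5 = q ->
    R' 6 = R 6 -> R' 7 = z i -> ~~ match_extends z n (len_of S M) (edge_of S M) i q ->
    reach w 10 (State 62 R' M) (progress m).
  move=> r10 F' r4' r5' r6' r7' exN; have [g0 g1 g2 g3 g13 gM] := F'.
  do_jumpeq => [q0 | q0].
    rewrite q0 in W exN; do_const; do_plus; do_jump; apply: reach0.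
    rewrite addn1.
    have [W' max1] := match_walk_root T S_gt1 W exN lei.
    apply: (@progress_inv _ m.-1); first by lia.
    apply: InvMatch (T) (W') _ _ _; rewrite ?updE //=.
    - by lia.
    - by rewrite r6'; apply: best_keep.
    - by rewrite r6'.
    by move: lem; rewrite /match_cost (len1 T); lia.
  have [W' ltl] := match_walk_link T W exN q0.
  do_plus; do_read (link_of S M q) => //; do_jump; apply: reach0.
  apply: (@progress_inv _ m.-1); first by lia.
  apply: InvMatchSuffix (T) (W') _ _ _; rewrite ?updE //= ?r6' //.
  - by rewrite lei.
  by move: lem; rewrite /match_cost; lia.
do_plus; do_read (len_of S M q) => //; do_plus; do_jumplt => [ltlq | leqi].
  apply: (@reachW _ 10) => //.
  apply: walk_on; rewrite ?updE //=.
  by rewrite /match_extends leqNgt addnC ltlq.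
do_minus; do_read (z (i - len_of S M q)); first by rewrite hM //; lia.
do_jumpeq => [zE | zN]; last first.
  apply: (@reachW _ 10) => //.
  apply: walk_on; rewrite ?updE //=.
  by rewrite /match_extends; case: eqP => //; rewrite andbF.
do_plus; do_times; do_plus; do_read (edge_of S M q (z i)).
  by rewrite edge_ofE.
do_jumpeq => [e0 | e0].
  apply: (@reachW _ 10) => //.
  apply: walk_on; rewrite ?updE //=.
  by rewrite /match_extends e0 eqxx !andbF.
have exq : match_extends z n (len_of S M) (edge_of S M) i q.
  by rewrite /match_extends zE eqxx addnC leqi; apply/eqP.
have [W' lE palL knownL maxL] := match_walk_edge T W exq.
have [nu lue _ _] := W'; have ltu := nu.1.
have lK : n + (len_of S M q).+2 <= i.+2 by lia.
have B' := best_step B lei lK palL knownL maxL.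
have cost : match_cost M i.+1 (edge_of S M q (z i)) + 3 <= m.-1.
  by move: lem; rewrite /match_cost lE; lia.
have ltm : m.-1 < m by lia.
do 4 do_plus; rewrite !addn1 addn0.
do_jumplt => [ltans | leans].
  apply: reach0; apply: (progress_inv ltm).
  apply: InvMatch (T) (W') _ _ cost; rewrite ?updE //=.
  - by lia.
  - by rewrite (maxn_idPl (ltnW ltans)) in B'.
do_plus; do_jump; apply: reach0; apply: (progress_inv ltm).
apply: InvMatch (T) (W') _ _ cost; rewrite ?updE //= ?addn0 //.
- by lia.
- by rewrite (maxn_idPr leans) in B'.
Qed.

Lemma step_match m s R M i q : s = State 53 R M -> frame R M -> R 4 = i ->
  R 5 = q -> n <= i <= N -> tree M n -> match_walk z S n (len_of S M) i q ->
  best z S n (len_of S M) i (R 6) -> 0 < R 6 -> match_cost M i q + 3 <= m ->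
  reach w 40 s (progress m).
Proof.
move=> -> F r4 r5 /andP[lei leiN] T W B ans0 lem.
have [h0 h1 h2 h3 h13 hM] := F; have Sw := S_word.
have SE : S = N.+2 by [].
do_jumpeq => [iE | iN].
  have [[j [lej lR _ _]] _] := B.
  do_minus; apply: reach0; left; split=> //; exists M => //.
  rewrite /output /= updE /=; have -> : (R 6 - 1).+1 = R 6 by lia.
  by rewrite -iE.
do_read (z i); first by rewrite hM //; lia.
apply: reach0; apply: (@progress_inv _ m.-1); first by lia.
apply: InvMatchSuffix (T) (W) _ _ _; rewrite ?updE //=.
- by lia.
by lia.
Qed.

Lemma inv_final m s : inv m s -> reach w (40 * m.+1) s final.
Proof.
apply: reach_descent => {}m {}s [] R M.
- by move=> i q *; apply: (@step_build m _ R M i q).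
- by move=> i q *; apply: (@step_suffix m _ R M i q).
- by move=> i q r *; apply: (@step_link m _ R M i q r).
- by move=> i q *; apply: (@step_match m _ R M i q).
- by move=> i q *; apply: (@step_match_suffix m _ R M i q).
Qed.

Lemma run_final R M : R 0 = n -> R 1 = N - n -> (forall r, 1 < r -> R r = 0) ->
  (forall a, M a = z a) -> reach w (1000 * N.+1) (State 0 R M) final.
Proof.
move=> r0 r1 r_0 Mz; have Sw := S_word; have SE : S = N.+2 by [].
have r4 : R 4 = 0 by apply: r_0.
have r13 : R 13 = 0 by apply: r_0.
(* Seven initial instructions, then an initial potential of at most [8 * N + 20]. *)
apply: (@reachW _ (7 + 40 * (8 * N + 20).+1)) => //; first by lia.
apply: reach_trans (inv (8 * N + 20)) _ _ _; last exact: inv_final.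
do_plus; do_const; do 2 do_plus; do_const; do_plus; do_write; apply: reach0.
have -> : n + (N - n) = N by lia.
have -> : N + 1 + 1 = S by rewrite SE; lia.
(* Memory past the input is zero, so the single write of the length of node 1 sets up the initial
   tree. *)
have Tout v : N <= v -> M v = 0 by move=> leN; rewrite Mz z_out.
have T : tree (upd M (S + 1) 1) 0.
  apply: eertree0 => //.
  - move=> v ltv; rewrite /len_of updE eqn_add2l; case: eqP => // _.
    by apply: Tout; lia.
  - by move=> v ltv; rewrite /link_of updE ifN ?Tout //; lia.
  - move=> v [|a] ltv //=; rewrite mulSn updE ifN ?Tout //; lia.
apply: (InvBuild (i := 0) (q := 1)) (T) _ _; rewrite ?updE //=.
- by split; rewrite ?updE //= => j ltj; rewrite updE ifN ?Mz //; lia.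
- by apply: suffix_walk_init => //; exact: (len1 T).
rewrite /build_cost (len1 T).
have -> : link_of S (upd M (S + 1) 1) 1 = 0.
  by rewrite /link_of updE ifN ?Tout //; lia.
by rewrite (len0 T); lia.
Qed.

End Run.

(** * From positions to strings *)

Definition occurs_end (p : seq nat) (z : nat -> nat) (e : nat) : Prop :=
  size p <= e /\ forall d, d < size p -> nth 0 p d = z (e - size p + d).

Lemma infix_occurs_end (p s : seq nat) :
  infix p s <-> exists2 e, e <= size s & occurs_end p (nth 0 s) e.
Proof.
split=> [/infixP[s1 [s2 ->]] | [e lee [lepe pE]]].
  exists (size s1 + size p); first by rewrite !size_cat addnA leq_addr.
  split=> [|d ltd]; first exact: leq_addl.
  by rewrite addnK nth_cat ltnNge leq_addr /= addKn nth_cat ltd.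
apply/infixP; exists (take (e - size p) s), (drop (size p) (drop (e - size p) s)).
have pE' : p = take (size p) (drop (e - size p) s).
  apply: (@eq_from_nth _ 0) => [|d ltd].
    by rewrite size_takel // size_drop; lia.
  by rewrite nth_take // nth_drop pE.
by rewrite [X in _ ++ X ++ _]pE' !cat_take_drop.
Qed.

Lemma occurs_end_pal (p : seq nat) z e : occurs_end p z e ->
  palindrome p <-> pal_end z e (size p).+1.
Proof.
move=> [lepe pE]; split=> [/eqP palp j k ltj ltk jk | palz].
  have -> : j = e - size p + (j - (e - size p)) by lia.
  have -> : k = e - size p + (k - (e - size p)) by lia.
  rewrite -!pE; try lia.
  by rewrite {1}palp nth_rev; [congr nth; lia | lia].
apply/eqP; apply: (@eq_from_nth _ 0) => [|d ltd]; first by rewrite size_rev.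
by rewrite nth_rev // !pE; try lia; apply: palz; lia.
Qed.

Lemma occurs_end_same (p : seq nat) z e e' : occurs_end p z e ->
  size p <= e' -> occurs_end p z e' <-> same_end z e e' (size p).+1.
Proof.
move=> [lepe pE] lepe'; split=> [[_ pE'] a b lta ltea ab | ee'].
  have -> : a = e - size p + (a - (e - size p)) by lia.
  have -> : b = e' - size p + (a - (e - size p)) by lia.
  by rewrite -pE -?pE' //; lia.
by split=> // d ltd; rewrite pE //; apply: ee'; lia.
Qed.

Lemma best_LPALCF (x y : seq nat) S len link edge l (z := nth 0 (x ++ y)) :
  eertree z S (size x) len link edge ->
  best z S (size x) len (size x + size y) l.+1 -> is_LPALCF x y l.
Proof.
move=> T [[j [/andP[lenj lej] lelj palj [u [nu lu su]]]] maxl].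
have zx e d : e <= size x -> d < e -> nth 0 x d = z d.
  by move=> lee ltd; rewrite /z nth_cat ifT //; lia.
have zy d : nth 0 y d = z (size x + d).
  by rewrite /z nth_cat ltnNge leq_addr /= addKn.
have occ_x p e : e <= size x -> occurs_end p (nth 0 x) e <-> occurs_end p z e.
  move=> lee; split=> -[lep pE]; split=> // d ltd.
    by rewrite pE // (zx e) //; lia.
  by rewrite pE // (zx e) //; lia.
have occ_y p e : size p <= e ->
    occurs_end p (nth 0 y) e <-> occurs_end p z (size x + e).
  move=> lep; split=> -[? pE]; (split=> [|d ltd]; first by lia).
    by rewrite pE // zy; congr z; lia.
  by rewrite pE // zy; congr z; lia.
split.
  exists (take l (drop (j - l) (x ++ y))); last first.
    by rewrite size_takel // size_drop size_cat; lia.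
  set p := take _ _.
  have sp : size p = l by rewrite size_takel // size_drop size_cat; lia.
  have pj : occurs_end p z j.
    by rewrite /occurs_end sp; split=> [|d ltd]; [lia | rewrite nth_take // nth_drop].
  apply/and3P; split.
  - by apply/(occurs_end_pal pj); rewrite sp.
  (* The node itself marks an occurrence in [x], ending at [u.-1]. *)
  - have [leun lu' _] := node_pal T nu.
    apply/infix_occurs_end; exists u.-1; first by lia.
    apply/occ_x; first by lia.
    by apply/(occurs_end_same pj); rewrite sp //; lia.
  - apply/infix_occurs_end; exists (j - size x); first by lia.
    apply/occ_y; first by lia.
    by have -> : size x + (j - size x) = j by lia.
move=> p /and3P[palp /infix_occurs_end[ex lex px] /infix_occurs_end[ey ley py]].
have lpy := py.1; have {}px := (occ_x p ex lex).1 px.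
have {}py := (occ_y p ey lpy).1 py.
have palx := (occurs_end_pal px).1 palp; have paly := (occurs_end_pal py).1 palp.
rewrite -ltnS; apply: (maxl (size x + ey)); [lia | lia | exact: paly |].
(* The occurrence in [x] provides the node that makes the occurrence in [y] known. *)
have lpx : (size p).+1 <= ex.+1 := px.1; have [v [nv lv sv]] := node_complete T lex lpx palx.
exists v; split=> //; apply: same_end_trans sv; first by lia.
by apply/(occurs_end_same py).
Qed.

Theorem theorem3 (c : nat) :
  exists (P : program) (k C : nat), forall (w : nat) (x y : seq nat),
    word_size_ok k (size x + size y) w ->
    over_integer_alphabet c x y ->
    computes_within w P x y (C * (size x + size y + 1)) (is_LPALCF x y).
Proof.
(* With [N] the total length, addresses stay below [5 * (N + 2) ^ (c + 1)]; three more factors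
   [N + 2 >= 2] contribute at least 8 and absorb the 5. *)
exists lpalcf_program, (c + 4), 1000 => w x y ok_w /allP alpha.
set N := size x + size y in ok_w alpha *; set z := nth 0 (x ++ y).
have le_xN : size x <= N by exact: leq_addr.
have z_out j : N <= j -> z j = 0.
  by move=> leNj; rewrite /z nth_default // size_cat.
have z_alpha j : j < N -> 1 <= z j <= N ^ c.
  by move=> ltj; apply/alpha/mem_nth; rewrite size_cat.
have z_gt0 j : j < N -> 0 < z j by case/z_alpha/andP.
have z_word j : (z j + 4) * N.+2 < 2 ^ w.
  apply: leq_trans ok_w; rewrite addn2 expnD.
  have zb : z j <= N.+2 ^ c.
    have [/z_alpha/andP[_ zj] | /z_out -> //] := ltnP j N.
    by apply: leq_trans zj _; case: c {alpha z_alpha} => // c; rewrite leq_exp2r //; lia.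
  have b_gt0 : 0 < N.+2 ^ c by rewrite expn_gt0.
  rewrite [_ ^ 4](_ : _ = N.+2 * N.+2 * N.+2 * N.+2) ?expnS ?expn0; last by lia.
  have le1 : (z j + 4) * N.+2 <= 5 * N.+2 ^ c * N.+2 by rewrite leq_mul2r; lia.
  apply: leq_ltn_trans le1 _.
  have -> : N.+2 ^ c * (N.+2 * N.+2 * N.+2 * N.+2) =
    (N.+2 * N.+2 * N.+2) * N.+2 ^ c * N.+2 by lia.
  rewrite ltn_mul2r /= ltn_mul2r b_gt0 /=.
  by apply: (@leq_trans (2 * 2 * 2)) => //; do 2 apply: leq_mul => //.
have N_word : N < 2 ^ w by have := z_word N; rewrite z_out //; lia.
have z_small j : z j < 2 ^ w.
  by apply: leq_ltn_trans (z_word j); nia.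
have [||r|a|t leT [halt [M T B]]] := @run_final w (size x) N z le_xN z_gt0 z_out
  z_word (regs (init w x y)) (memory (init w x y)).
- by rewrite /= /to_word modn_small //; lia.
- by rewrite /= /to_word modn_small /N //; lia.
- by case: r => [|[|r]] // _; rewrite /= /to_word nth_nil mod0n.
- by rewrite /= /to_word modn_small.
exists t; split=> //; first by rewrite addn1.
exact: best_LPALCF T B.
Qed.
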